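(* Let $m\ge 1$, let $D\subset\mathbb{R}^m$ be nonempty and closed, and suppose there exist constants $r>0$ and $\eta\in(0,1]$ such that the following exterior cone condition holds: for every $f\in\partial D$, $$(f+\breve K^r_\nu(\eta))\cap D=\emptyset\quad\text{for some unit vector }\nu=\nu_f\in\partial\overline B(1).$$ Let $\partial_{\rm s}D$ be the scalarization-implied boundary of $D$ (constructed with these constants $r,\eta$ and $\epsilon=r/3$), i.e. $$\partial_{\rm s}D=\big\{f\in D:\ \phi^{(k)}_{a,b}(f)=V^{(k)}_{a,b}\ \text{for some } a\in\mathbb{R}^m,\ b\in\partial\overline B(1),\ k\in\mathbb{Z}_{++}\ \text{such that } V^{(k+1)}_{a,b}=V^{(k)}_{a,b}\big\}.$$ Then $\partial D=\partial_{\rm s}D$.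
   Context: $\langle\cdot,\cdot\rangle$ and $\|\cdot\|$ are the Euclidean inner product and norm on $\mathbb{R}^m$; $\mathbb{Z}_{++}=\{1,2,\dots\}$. $\overline B(r)=\{\beta\in\mathbb{R}^m:\|\beta\|\le r\}$, and $\partial\overline B(1)=\{\beta\in\mathbb{R}^m:\|\beta\|=1\}$ is the unit sphere. The boundary is $\partial D=\mathrm{cl}\,D\setminus\mathrm{int}\,D$. For a unit vector $\nu$ and $\eta\in(0,1]$, the circular cone is $K_\nu(\eta)=\{\beta\in\mathbb{R}^m:(1-\eta)\|\beta\|\le\langle\beta,\nu\rangle\}$; the spherical cone of radius $r$ is $K^r_\nu(\eta)=\overline B(r)\cap K_\nu(\eta)$, and its partially open version is $\breve K^r_\nu(\eta)=\overline B(r)\cap\mathrm{int}\,K_\nu(\eta)$. Put $\epsilon=r/3$. For $f\in D$, $a\in\mathbb{R}^m$, $b\in\partial\overline B(1)$, $k\in\mathbb{Z}_{++}$, define the scalarization set, scalarization function, and value function $$\mathfrak S^{(k)}_{a,b}(f)=\{y\in[0,k\epsilon]: f-a-yb\in K^\epsilon_b(\eta)\},\qquad \phi^{(k)}_{a,b}(f)=\sup_{y\in\mathfrak S^{(k)}_{a,b}(f)}y,\qquad V^{(k)}_{a,b}=\sup_{f\in D}\phi^{(k)}_{a,b}(f).$$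
   Formalization: In the definition of the scalarization-implied boundary, the scalarization set of f is also required to be nonempty; otherwise, with sup of the empty set equal to −∞ (or 0), taking a far from a closed ball D would put all of D in it and the claim would fail. *)

(* Defs.v *)
From mathcomp Require Import all_boot all_order all_algebra.
From mathcomp Require Import all_classical all_reals all_analysis.
Set Implicit Arguments.
Unset Strict Implicit.
Unset Printing Implicit Defensive.
Import Order.TTheory GRing.Theory Num.Theory.
Import numFieldNormedType.Exports.

Local Open Scope classical_set_scope.
Local Open Scope ring_scope.

(* R^m is 'rV[R]_m. Its library norm `|x| is the max norm, hence the separate
   Euclidean norm below; the library topology is the usual one of R^m. *)

Definition inner {R : realType} {m : nat} (u v : 'rV[R]_m) : R :=
  \sum_(i < m) u ord0 i * v ord0 i.

Definition enorm {R : realType} {m : nat} (u : 'rV[R]_m) : R :=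
  Num.sqrt (inner u u).

Definition unit_sphere {R : realType} {m : nat} : set 'rV[R]_m :=
  [set b | enorm b = 1].

Definition eball {R : realType} {m : nat} (r : R) : set 'rV[R]_m :=
  [set b | enorm b <= r].

Definition boundary {T : topologicalType} (D : set T) : set T :=
  closure D `\` interior D.

Definition circular_cone {R : realType} {m : nat}
    (nu : 'rV[R]_m) (eta : R) : set 'rV[R]_m :=
  [set b | (1 - eta) * enorm b <= inner b nu].

Definition spherical_cone {R : realType} {m : nat}
    (r : R) (nu : 'rV[R]_m) (eta : R) : set 'rV[R]_m :=
  eball r `&` circular_cone nu eta.

Definition open_spherical_cone {R : realType} {m : nat}
    (r : R) (nu : 'rV[R]_m) (eta : R) : set 'rV[R]_m :=
  eball r `&` interior (circular_cone nu eta).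

Definition exterior_cone_condition {R : realType} {m : nat}
    (r eta : R) (D : set 'rV[R]_m) : Prop :=
  forall f, boundary D f ->
    exists nu, unit_sphere nu /\
      [set f + c | c in open_spherical_cone r nu eta] `&` D = set0.

Definition scal_set {R : realType} {m : nat} (r eta : R) (k : nat)
    (a b f : 'rV[R]_m) : set R :=
  [set y | 0 <= y <= k%:R * (r / 3) /\
           spherical_cone (r / 3) b eta (f - a - y *: b)].

(* The supremum of the empty set is -oo. *)
Definition scal_fun {R : realType} {m : nat} (r eta : R) (k : nat)
    (a b f : 'rV[R]_m) : \bar R :=
  ereal_sup [set y%:E | y in scal_set r eta k a b f].

Definition scal_value {R : realType} {m : nat} (r eta : R) (D : set 'rV[R]_m)
    (k : nat) (a b : 'rV[R]_m) : \bar R :=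
  ereal_sup [set scal_fun r eta k a b f | f in D].

(* The equality of f's scalarization with the value is one between real
   numbers: it presupposes that f can be scalarized, i.e. that the set whose
   supremum is taken is nonempty. Without this, if a is so far from a bounded D
   that every scalarization set is empty, both values would be -oo and all of D,
   including its interior, would qualify. *)
Definition scal_boundary {R : realType} {m : nat} (r eta : R)
    (D : set 'rV[R]_m) : set 'rV[R]_m :=
  [set f | D f /\
    exists (a b : 'rV[R]_m) (k : nat),
      [/\ unit_sphere b, (0 < k)%N,
          scal_value r eta D k.+1 a b = scal_value r eta D k a b,
          scal_set r eta k a b f !=set0 &
          scal_fun r eta k a b f = scal_value r eta D k a b]].

(* Main.v *)
Require Import Defs.
From mathcomp Require Import all_boot all_order all_algebra.
From mathcomp Require Import all_classical all_reals all_analysis.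
From mathcomp Require Import ring lra.
Set Implicit Arguments.
Unset Strict Implicit.
Import Order.TTheory GRing.Theory Num.Theory.
Import numFieldNormedType.Exports.
Local Open Scope classical_set_scope.
Local Open Scope ring_scope.

(** Write [eps = r / 3].

    A boundary point [f] comes with an exterior cone of some axis [nu].  It is
    exposed by taking [a = f], [b = nu] and [k = 1]: the truncated cone
    [f + K^eps] reaches [f] at level [y = 0], so the value is at least [0].
    If a point [g] of [D] were reached at a level [0 < y <= 2 * eps], then
    [g - f] would lie in [y *: nu + K^eps].  Sliding a cone along its axis
    pushes it into its own interior ([circular_cone_shift_interior]), and the
    norm of [g - f] is at most [y + eps <= r]; so [g] would lie in the forbidden
    cone at [f].  Hence the values for [k = 1] and [k = 2] are both [0]
    ([scal_value_at_boundary]); the radius [r] is three times [eps] because one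
    [eps] is the size of the truncated cone and two are spent on the levels.

    Conversely, an interior point [f] of [D] can be moved a little along [b]
    without leaving [D], which raises each of its levels by the same amount
    [t <= eps].  The levels so obtained exceed [k * eps] by at most [eps], so
    they count for [k + 1]: stability of the value from [k] to [k + 1] then
    prevents [f] from attaining it ([interior_not_scal_boundary]). *)

Section InnerProduct.
Context {R : realType} {m : nat}.
Implicit Types u v b : 'rV[R]_m.

Lemma innerC u v : inner u v = inner v u.
Proof. by apply: eq_bigr => i _; rewrite mulrC. Qed.

Lemma innerDl u v b : inner (u + v) b = inner u b + inner v b.
Proof.
by rewrite /inner -big_split; apply: eq_bigr => i _; rewrite mxE mulrDl.
Qed.

Lemma innerZl (a : R) u b : inner (a *: u) b = a * inner u b.
Proof.
by rewrite /inner mulr_sumr; apply: eq_bigr => i _; rewrite mxE mulrA.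
Qed.

Lemma inner0l u : inner 0 u = 0.
Proof. by rewrite -(scale0r (0 : 'rV[R]_m)) innerZl mul0r. Qed.

Lemma inner_ge0 u : 0 <= inner u u.
Proof. by apply: sumr_ge0 => i _; rewrite -expr2 sqr_ge0. Qed.

Lemma enorm_ge0 u : 0 <= enorm u.
Proof. exact: sqrtr_ge0. Qed.

Lemma enorm_sqr u : enorm u ^+ 2 = inner u u.
Proof. exact: sqr_sqrtr (inner_ge0 u). Qed.

Lemma enorm0 : enorm (0 : 'rV[R]_m) = 0.
Proof. by rewrite /enorm inner0l sqrtr0. Qed.

Lemma inner_unit b : enorm b = 1 -> inner b b = 1.
Proof. by rewrite -enorm_sqr => ->; rewrite expr1n. Qed.

(** The square of the norm of [u - inner u b *: b], the component of [u]
    orthogonal to the unit vector [b], is [enorm u ^+ 2 - inner u b ^+ 2]. *)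
Lemma inner_le_enorm u b : enorm b = 1 -> inner u b <= enorm u.
Proof.
move=> b1; have bb := inner_unit b1.
have := inner_ge0 (u + - inner u b *: b).
rewrite innerDl innerZl ![inner _ (u + _)]innerC !innerDl !innerZl bb.
rewrite (innerC b u) -(enorm_sqr u) => h.
apply: le_trans (ler_norm _) _.
rewrite -(ler_pXn2r (n := 2)) ?nnegrE ?enorm_ge0 //.
by rewrite real_normK ?num_real //; nra.
Qed.

Lemma enorm_axis_shift (y : R) b v :
  enorm b = 1 -> 0 <= y -> enorm (y *: b + v) <= y + enorm v.
Proof.
move=> b1 y0; have bb := inner_unit b1.
have v0 := enorm_ge0 v; have vb := inner_le_enorm v b1.
rewrite -(ler_pXn2r (n := 2)) ?nnegrE ?enorm_ge0 ?addr_ge0 //.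
rewrite enorm_sqr innerDl innerZl ![inner _ (y *: b + _)]innerC.
rewrite !innerDl !innerZl bb (innerC b v) -(enorm_sqr v).
nra.
Qed.

Lemma continuous_inner (f g : 'rV[R]_m -> 'rV[R]_m) :
  continuous f -> continuous g -> continuous (fun u => inner (f u) (g u)).
Proof.
move=> fc gc; apply: (continuous_big add_continuous) => i _ u.
have coordc (h : 'rV[R]_m -> 'rV[R]_m) :
    continuous h -> h v ord0 i @[v --> u] --> h u ord0 i.
  by move=> hc; apply: cvg_comp (hc u) (@coord_continuous R _ _ ord0 i (h u)).
exact: (cvgM (coordc _ fc) (coordc _ gc)).
Qed.

Lemma continuous_enorm : continuous (enorm : 'rV[R]_m -> R).
Proof.
have innerc : continuous (fun u => inner u u : R).
  by apply: (@continuous_inner id id) => x; exact: cvg_id.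
by move=> u; exact: cvg_comp (innerc u) (@sqrt_continuous R _).
Qed.

End InnerProduct.

Section Cones.
Context {R : realType} {m : nat}.
Implicit Types (u v b nu : 'rV[R]_m) (eta y : R).

Lemma circular_cone_interior nu eta u :
  (1 - eta) * enorm u < inner u nu -> interior (circular_cone nu eta) u.
Proof.
move=> hu; pose g := fun v : 'rV[R]_m => inner v nu - (1 - eta) * enorm v.
have innerc : continuous (fun v : 'rV[R]_m => inner v nu).
  by apply: (continuous_inner (f := id) (g := fun=> nu));
    [by move=> v; exact: cvg_id | exact: cst_continuous].
have gc : continuous g.
  move=> v; have vF : Filter (nbhs v) := nbhs_filter v.
  exact: cvgB (innerc v) (cvgM (cvg_cst (1 - eta)) (@continuous_enorm R m v)).
have go : open (g @^-1` [set x | x > 0]).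
  by apply: open_comp => [v _|]; [exact: gc | exact: open_gt].
apply: (@filterS _ (nbhs u) _ (g @^-1` [set x | x > 0])).
  by move=> v /=; rewrite /g /circular_cone /= subr_gt0 => /ltW.
by apply: open_nbhs_nbhs; split => //=; rewrite /g subr_gt0.
Qed.

(** Moving by [y] along the axis adds [y] to the height [inner _ nu], but at
    most [(1 - eta) * y < y] to the height that the cone requires. *)
Lemma circular_cone_shift_interior nu eta y v :
  enorm nu = 1 -> 0 < eta <= 1 -> 0 < y -> circular_cone nu eta v ->
  interior (circular_cone nu eta) (y *: nu + v).
Proof.
move=> nu1 /andP[eta0 eta1] y0; rewrite /circular_cone /= => hv.
apply: circular_cone_interior; rewrite innerDl innerZl (inner_unit nu1).
have := enorm_axis_shift v nu1 (ltW y0).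
set n := enorm (_ + _); set k := enorm v in hv *; move=> hn.
have : (1 - eta) * n <= (1 - eta) * (y + k) by rewrite ler_wpM2l // subr_ge0.
nra.
Qed.

Lemma open_spherical_cone_shift (s r : R) nu eta y v :
  enorm nu = 1 -> 0 < eta <= 1 -> 0 < y -> y + s <= r ->
  spherical_cone s nu eta v -> open_spherical_cone r nu eta (y *: nu + v).
Proof.
move=> nu1 heta y0 ysr [vs vK]; split; last exact: circular_cone_shift_interior.
rewrite /eball /=; apply: le_trans ysr.
by apply: le_trans (enorm_axis_shift _ nu1 (ltW y0)) _; rewrite lerD2l.
Qed.

End Cones.

Section Scalarization.
Context {R : realType} {m : nat}.
Variables (r eta : R).
Implicit Types (D : set 'rV[R]_m) (a b f g nu : 'rV[R]_m) (k : nat).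

Lemma scal_set_apex k f nu : 0 < r -> scal_set r eta k f nu f 0.
Proof.
move=> r0; split; first by rewrite lexx mulr_ge0 ?ler0n ?divr_ge0 // ltW.
rewrite subrr scale0r subrr /spherical_cone /eball /circular_cone.
by split; rewrite /= enorm0 ?inner0l ?mulr0 // divr_ge0 // ltW.
Qed.

(** A point of [D] cannot be reached from [f] at a positive level: that level
    being at most [2 * (r / 3)], the point would lie in the open cone of radius
    [r] at [f], which misses [D]. *)
Lemma scal_set_exterior_cone D k f nu g y :
  0 < r -> 0 < eta <= 1 -> unit_sphere nu ->
  [set f + c | c in open_spherical_cone r nu eta] `&` D = set0 ->
  (k <= 2)%N -> D g -> scal_set r eta k f nu g y -> y <= 0.
Proof.
move=> r0 heta nu1 fD k2 Dg [/andP[_ yk] gK].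
rewrite leNgt; apply/negP => y0.
suff : ([set f + c | c in open_spherical_cone r nu eta] `&` D) g by rewrite fD.
split=> //; exists (g - f); last by rewrite addrC subrK.
have -> : g - f = y *: nu + (g - f - y *: nu) by rewrite [RHS]addrC subrK.
apply: open_spherical_cone_shift gK => //.
have : k%:R * (r / 3) <= 2%:R * (r / 3).
  by rewrite ler_wpM2r ?divr_ge0 ?ler_nat // ltW.
by lra.
Qed.

Lemma scal_fun_le_value D k a b f :
  D f -> (scal_fun r eta k a b f <= scal_value r eta D k a b)%E.
Proof. by move=> Df; apply: ereal_sup_ubound; exists f. Qed.

Lemma scal_set_le_fun k a b f y :
  scal_set r eta k a b f y -> (y%:E <= scal_fun r eta k a b f)%E.
Proof. by move=> fy; apply: ereal_sup_ubound; exists y. Qed.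

Lemma scal_value_at_boundary D k f nu :
  0 < r -> 0 < eta <= 1 -> unit_sphere nu -> D f ->
  [set f + c | c in open_spherical_cone r nu eta] `&` D = set0 ->
  (k <= 2)%N ->
  scal_fun r eta k f nu f = 0%E /\ scal_value r eta D k f nu = 0%E.
Proof.
move=> r0 heta nu1 Df fD k2.
have fun_ge0 : (0 <= scal_fun r eta k f nu f)%E.
  exact/scal_set_le_fun/scal_set_apex.
have value_le0 : (scal_value r eta D k f nu <= 0)%E.
  apply: ge_ereal_sup => _ [g Dg <-]; apply: ge_ereal_sup => _ [y gy <-].
  by rewrite lee_fin; exact: scal_set_exterior_cone fD k2 Dg gy.
have fun_le := @scal_fun_le_value D k f nu f Df.
split; apply/eqP; rewrite eq_le.
  by rewrite fun_ge0 (le_trans fun_le).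
by rewrite value_le0 (le_trans fun_ge0).
Qed.

Lemma scal_set_shift k a b f (t y : R) :
  0 <= t <= r / 3 -> scal_set r eta k a b f y ->
  scal_set r eta k.+1 a b (f + t *: b) (y + t).
Proof.
move=> /andP[t0 tr] [/andP[y0 yk] fK]; split.
  by rewrite addr_ge0 //= -natr1 mulrDl mul1r lerD.
suff -> : f + t *: b - a - (y + t) *: b = f - a - y *: b by [].
by apply/rowP => i; rewrite !mxE; ring.
Qed.

Lemma scal_fun_fin_num k a b f :
  scal_set r eta k a b f !=set0 -> scal_fun r eta k a b f \is a fin_num.
Proof.
move=> [y fy]; rewrite fin_numE -ltNye -ltey; apply/andP; split.
  exact: lt_le_trans (ltNyr y) (scal_set_le_fun fy).
apply: le_lt_trans (ltry (k%:R * (r / 3))).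
by apply: ge_ereal_sup => _ [z [/andP[_ zk] _] <-]; rewrite lee_fin.
Qed.

Lemma interior_shift D f b (e : R) :
  interior D f -> 0 < e -> exists2 t, 0 < t <= e & D (f + t *: b).
Proof.
move=> fD e0.
have shift_cvg : f + t *: b @[t --> (0 : R)^'+] --> f + 0 *: b.
  apply: cvg_at_right_filter.
  by apply: cvgD; [exact: cvg_cst | apply: cvgZr_tmp; exact: cvg_id].
rewrite scale0r addr0 in shift_cvg.
have tD : \forall t \near (0 : R)^'+, D (f + t *: b) by exact: shift_cvg.
near (0 : R)^'+ => t; exists t.
  by apply/andP; split; near: t; [exact: nbhs_right_gt | exact: nbhs_right_le].
by near: t.
Unshelve. all: by end_near. Qed.

(** Passing from [f] to [f + t *: b] turns every level [y] of [f] for [k] into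
    the level [y + t] for [k.+1], so the value for [k.+1] is at least
    [scal_fun f + t]. *)
Lemma interior_not_scal_boundary D f :
  0 < r -> interior D f -> ~ scal_boundary r eta D f.
Proof.
move=> r0 fD [Df [a [b [k [_ _ stable fS attained]]]]].
have [t /andP[t0 tr] Dt] : exists2 t, 0 < t <= r / 3 & D (f + t *: b).
  by apply: interior_shift fD _; rewrite divr_gt0.
have ffin := scal_fun_fin_num fS; set v := fine (scal_fun r eta k a b f).
have vE : scal_fun r eta k a b f = v%:E by rewrite fineK.
have : (scal_fun r eta k a b f <= (v - t)%:E)%E.
  apply: ge_ereal_sup => _ [y fy <-]; rewrite lee_fin lerBrDr -lee_fin -vE.
  rewrite attained -stable; apply: le_trans (@scal_fun_le_value _ _ _ _ _ Dt).
  by apply/scal_set_le_fun/scal_set_shift => //; rewrite ltW.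
by rewrite vE lee_fin; lra.
Qed.

End Scalarization.

Theorem theorem3p3 (R : realType) (m : nat) (hm : (1 <= m)%N)
    (D : set 'rV[R]_m) (D_nonempty : D !=set0) (D_closed : closed D)
    (r eta : R) (r_gt0 : 0 < r) (eta_range : 0 < eta <= 1)
    (D_cone : exterior_cone_condition r eta D) :
  boundary D = scal_boundary r eta D.
Proof.
apply/seteqP; split => f.
  move=> fbd; have [nu [nu1 fD]] := D_cone f fbd.
  have Df : D f by apply: D_closed; case: fbd.
  have at_boundary k := @scal_value_at_boundary _ _ _ _ _ k _ _
    r_gt0 eta_range nu1 Df fD.
  have [f1 V1] := at_boundary 1%N isT; have [_ V2] := at_boundary 2%N isT.
  split=> //; exists f, nu, 1%N; split=> //; rewrite ?V1 ?V2 ?f1 //.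
  by exists 0; exact: scal_set_apex.
move=> fs; split; first by apply: subset_closure; case: fs.
by move=> fint; exact: interior_not_scal_boundary fint fs.
Qed.
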